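(* Let $\mathcal{X}$ be a Polish space with metric $d$ and its Borel $\sigma$-algebra, and let $\mathcal{P}$ and $\mathcal{P}_n$ ($n\ge 1$) be nonempty, weakly compact, convex sets of Borel probability measures on $\mathcal{X}$ with $\lim_{n\to\infty}\overline{\mathrm{KL}}(\mathcal{P}_n,\mathcal{P})=0$. Then: (i) $\mathbb{E}^{\mathcal{P}_n}[\cdot]$ converges weakly to $\mathbb{E}^{\mathcal{P}}[\cdot]$, i.e. $\lim_{n\to\infty}\mathbb{E}^{\mathcal{P}_n}[\varphi]=\mathbb{E}^{\mathcal{P}}[\varphi]$ for every $\varphi\in C_b(\mathcal{X})$; (ii) if $D=\sup_{x,y\in\mathcal{X}}d(x,y)<+\infty$, then $\lim_{n\to\infty}\mathcal{W}_1(\mathcal{P}_n,\mathcal{P})=0$.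
   Context: ''Weakly compact'' means compact in the topology of weak convergence of probability measures; $C_b(\mathcal{X})$ is the set of bounded continuous real functions on $\mathcal{X}$. For probability measures $\mu,\nu$: $\mathrm{KL}(\mu\parallel\nu)=\int_{\mathcal{X}}\log\left(\frac{d\mu}{d\nu}\right)d\mu$ (natural logarithm) if $\mu\ll\nu$, and $+\infty$ otherwise; $W_1(\mu,\nu)=\inf\{E[d(X,Y)]:\mathrm{law}(X)=\mu,\ \mathrm{law}(Y)=\nu\}$ (infimum over all couplings). For sets of probability measures: $\mathrm{KL}(\mathcal{P}\parallel\mathcal{Q}):=\sup_{\mu\in\mathcal{P}}\inf_{\nu\in\mathcal{Q}}\mathrm{KL}(\mu\parallel\nu)$ (extended-real valued); $\overline{\mathrm{KL}}(\mathcal{P},\mathcal{Q}):=\mathrm{KL}(\mathcal{P}\parallel\mathcal{Q})+\mathrm{KL}(\mathcal{Q}\parallel\mathcal{P})$; $\mathcal{W}_1(\mathcal{P},\mathcal{Q}):=\max\left(\sup_{\mu\in\mathcal{P}}\inf_{\nu\in\mathcal{Q}}W_1(\mu,\nu),\ \sup_{\nu\in\mathcal{Q}}\inf_{\mu\in\mathcal{P}}W_1(\mu,\nu)\right)$. The sublinear expectation is $\mathbb{E}^{\mathcal{P}}[\varphi]:=\sup_{\mu\in\mathcal{P}}\int\varphi\,d\mu$. *)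

(* Defs.v *)
From HB Require Import structures.
From mathcomp Require Import all_boot all_order all_algebra.
From mathcomp Require Import all_classical all_reals all_analysis.

Set Implicit Arguments.
Unset Strict Implicit.
Unset Printing Implicit Defensive.

Import Order.TTheory GRing.Theory Num.Theory.
Import numFieldNormedType.Exports.

Local Open Scope classical_set_scope.
Local Open Scope ring_scope.

(* The measurable types of the library are pointed, hence so are the metric
   spaces carrying a Borel sigma-algebra.  This only excludes the empty space,
   on which there is no probability measure. *)
#[short(type="pmetricType")]
HB.structure Definition PointedMetric (K : numDomainType) :=
  {M of Metric K M & isPointed M}.

Definition separable (T : topologicalType) :=
  exists2 D : set T, countable D & dense D.

(* [rho] need not be the distance with which a metric space [T] is equipped:
   being Polish is a property of the topology only. *)
Definition completely_metrizable (R : realType) (T : topologicalType) :=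
  exists rho : T -> T -> R,
    [/\ [/\ forall x y, rho x y = 0 <-> x = y,
            forall x y, rho x y = rho y x &
            forall x y z, rho x z <= rho x y + rho y z],
        forall (x : T) (A : set T), nbhs x A <->
          exists2 e : R, 0 < e & [set y | rho x y < e] `<=` A &
        forall u : nat -> T,
          (forall e : R, 0 < e -> exists N : nat, forall m n : nat,
             (N <= m)%N -> (N <= n)%N -> rho (u m) (u n) < e) ->
          exists l : T, u n @[n --> \oo] --> l].

Definition polish (R : realType) (T : topologicalType) :=
  separable T /\ completely_metrizable R T.

Section borel.
Context {R : realType} (X : pmetricType R).

Definition borel : Type := g_sigma_algebraType (@open X).

HB.instance Definition _ :=
  Measurable.copy borel (g_sigma_algebraType (@open X)).

Definition borel_prob : Type := probability borel R.

HB.instance Definition _ := gen_eqMixin borel_prob.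
HB.instance Definition _ := gen_choiceMixin borel_prob.

Definition Cb : set (X -> R) := [set f | continuous f /\ bounded_fun f].

Definition integral_Cb (mu : borel_prob) : {ptws {f : X -> R | Cb f} -> R} :=
  fun f => \int[mu]_x sval f x.

(* Topology of weak convergence: the coarsest one that makes continuous
   mu |-> \int f dmu for every f in Cb. *)
HB.instance Definition _ :=
  Topological.copy borel_prob (initial_topology integral_Cb).

Definition weakly_compact (P : set borel_prob) := compact P.

(* Measures of the library are functions on all sets, whose values on
   non-measurable sets are irrelevant: the mixture is determined on Borel
   sets only. *)
Definition convex_probs (P : set borel_prob) :=
  forall (mu nu : borel_prob) (t : R), P mu -> P nu -> 0 <= t <= 1 ->
    exists2 lam : borel_prob, P lam &
      forall A : set borel, measurable A ->
        lam A = (t%:E * mu A + (1 - t)%:E * nu A)%E.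

End borel.

Section divergence.
Context d (T : measurableType d) (R : realType).
Local Open Scope ereal_scope.
Local Open Scope charge_scope.
Implicit Types (mu nu : probability T R) (P Q : set (probability T R)).

Definition KL mu nu : \bar R :=
  if `[< mu `<< nu >]
  then \int[mu]_x lne (('d (charge_of_finite_measure mu) '/d nu) x)
  else +oo.

Definition KL_sets P Q : \bar R :=
  ereal_sup [set ereal_inf [set KL mu nu | nu in Q] | mu in P].

Definition KL_sym P Q : \bar R := KL_sets P Q + KL_sets Q P.

Definition sublinear_expectation P (phi : T -> R) : \bar R :=
  ereal_sup [set \int[mu]_x (phi x)%:E | mu in P].

End divergence.

Section wasserstein.
Context {R : realType} {X : pmetricType R}.
Local Open Scope ereal_scope.
Implicit Types (mu nu : borel_prob X) (P Q : set (borel_prob X)).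

(* Laws of pairs with the given marginals.  They live on the product
   sigma-algebra, which on a separable space is the Borel one. *)
Definition couplings mu nu
    : set (probability (borel X * borel X)%type R) :=
  [set pi | forall A : set (borel X), measurable A ->
     pushforward pi fst A = mu A /\ pushforward pi snd A = nu A].

Definition W1 mu nu : \bar R :=
  ereal_inf [set \int[pi]_z (mdist (z.1 : X) (z.2 : X))%:E
            | pi in couplings mu nu].

Definition W1_sets P Q : \bar R :=
  maxe (ereal_sup [set ereal_inf [set W1 mu nu | nu in Q] | mu in P])
       (ereal_sup [set ereal_inf [set W1 mu nu | mu in P] | nu in Q]).

Definition diameter (Y : metricType R) : \bar R :=
  ereal_sup [set (mdist p.1 p.2)%:E | p in [set: Y * Y]].

End wasserstein.

(* Main.v *)
Require Import Defs.
From HB Require Import structures.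
From mathcomp Require Import all_boot all_order all_algebra.
From mathcomp Require Import all_classical all_reals all_analysis.
From mathcomp Require Import measurable_realfun ring lra.

Set Implicit Arguments.
Unset Strict Implicit.
Unset Printing Implicit Defensive.

Import Order.TTheory GRing.Theory Num.Theory.
Import numFieldNormedType.Exports.

Local Open Scope classical_set_scope.
Local Open Scope ring_scope.

(** The theorem is a uniform form of the fact that relative entropy controls
    total variation.  If [KL mu nu <= e ^+ 2] with [e] small, then
    [\int t dmu] and [\int t dnu] differ by at most [3 * e * M] for every
    measurable [t] with [`|t x| <= M] ([KL_integral_le]).  This is Pinsker's
    inequality up to the constant; it comes from the easy half of the
    Donsker-Varadhan duality, [\int t dmu + 1 <= KL mu nu + \int e^t dnu]
    ([Gibbs_variational]), applied to [t * e / M] and combined with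
    [e^s <= 1 + s + 2 s^2] near [0].

    The hypothesis makes [KL_sets (Pn n) P] and [KL_sets P (Pn n)] both small,
    since each is nonnegative.  So, for large [n], each measure of either set
    has a measure of the other set at small relative entropy, hence close in
    total variation.

    For (i), replacing each [mu] in one set by such a partner changes
    [\int phi dmu] by little, uniformly in [mu], so the two suprema are close
    ([sublinear_expectation_le] used in both directions).

    For (ii), the maximal coupling of two probabilities leaves their common
    part on the diagonal and transports only the excess, of mass
    [mu A - nu A] for a Hahn set [A] of [mu - nu].  Its cost is at most the
    diameter times this mass ([Hahn_coupling]), so [W1] is bounded by the total
    variation ([W1_le]).  The entropy may be taken in either order here because
    the coupling bound is symmetric: [mu A - nu A = nu (~` A) - mu (~` A)]. *)

(** * Relative entropy controls total variation *)

Section relative_entropy.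
Context d (T : measurableType d) (R : realType).
Implicit Types mu nu : probability T R.
Local Open Scope ereal_scope.
Local Open Scope charge_scope.

(** A real-valued logarithm [l] of the density [g] of [mu], although the density
    may vanish: as [ln 0 = 0], [l] is finite everywhere, and it differs from
    [lne g] only where [g = 0], which is [mu]-negligible.  The last clause is
    the change of variables [dmu = g dnu] together with [expR (- l) * g <= 1];
    it is not an equality because the mass that [nu] puts on [g = 0] is lost. *)
Lemma log_density mu nu : mu `<< nu -> exists l : T -> R,
  [/\ measurable_fun setT l,
      KL mu nu = \int[mu]_x (l x)%:E &
      forall k : T -> R, measurable_fun setT k -> (forall x, 0 <= k x)%R ->
        \int[mu]_x (k x * expR (- l x))%:E <= \int[nu]_x (k x)%:E].
Proof.
move=> munu; pose g := Radon_Nikodym_SigmaFinite.f mu nu.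
have g0 x : 0 <= g x := Radon_Nikodym_SigmaFinite.f_ge0 munu x.
have gfin x : g x \is a fin_num := Radon_Nikodym_SigmaFinite.f_fin_num munu x.
have mg : measurable_fun setT g.
  exact: measurable_int (Radon_Nikodym_SigmaFinite.f_integrable munu).
have mfg : measurable_fun setT (fun x => fine (g x)) by exact: measurableT_comp.
pose l x : R := ln (fine (g x)).
have ml : measurable_fun setT l by exact: measurableT_comp (@measurable_ln R) mfg.
(* [mu] does not charge the zeros of its own density *)
have gpos : ae_eq mu setT (fun x => lne (g x)) (fun x => (l x)%:E).
  have mZ : measurable [set x | g x = 0].
    by rewrite -[X in measurable X]setTI; exact: mg (emeasurable_set1 0).
  exists [set x | g x = 0]; split => //.
    transitivity (\int[nu]_(x in [set x | g x = 0]) g x).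
      exact: Radon_Nikodym_SigmaFinite.f_integral.
    by rewrite integral0_eq.
  move=> x /= /not_implyP[_]; apply: contra_notP => gx0.
  have : 0 < g x by rewrite lt0e g0 andbT; exact/eqP.
  by rewrite /l -{1 2}(fineK (gfin x)) lte_fin => /lne_EFin ->.
exists l; split => //.
- rewrite /KL asboolT//; apply: ae_eq_integral => //.
  + set f := 'd _ '/d _.
    have ffin x : f x \is a fin_num by exact: Radon_Nikodym_fin_num.
    have mf0 : measurable_fun setT f.
      exact: measurable_int (Radon_Nikodym_integrable _).
    have mf : measurable_fun setT (fun x => fine (f x)) by exact: measurableT_comp.
    rewrite (_ : (fun x => lne (f x)) =
      fun x => if (fine (f x) <= 0)%R then -oo else (ln (fine (f x)))%:E).
      apply: measurable_fun_ifT => //.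
      * exact: measurable_fun_ler.
      * by apply/measurable_EFinP; exact: measurableT_comp (@measurable_ln R) mf.
    apply/funext => x; rewrite -{1}(fineK (ffin x)).
    case: leP => [f0|f0]; first by rewrite le0_lneNy// lee_fin.
    by rewrite lne_EFin.
  + exact/measurable_EFinP.
  + apply: ae_eq_trans gpos; apply: ae_eq_comp.
    apply: (null_dominates_ae_eq measurableT munu).
    exact/ae_eq_sym/ae_eq_Radon_Nikodym_SigmaFinite.
- move=> k mk k0; rewrite -(Radon_Nikodym_SigmaFinite.change_of_variables munu)//.
  + apply: ge0_le_integral => //.
    * by move=> x _; rewrite mule_ge0// lee_fin mulr_ge0// expR_ge0.
    * apply: emeasurable_funM => //; apply/measurable_EFinP.
      apply: measurable_funM => //; apply: measurableT_comp => //.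
      exact: measurableT_comp.
    * exact/measurable_EFinP.
    * move=> x _; rewrite -/g -(fineK (gfin x)) -EFinM lee_fin -mulrA.
      rewrite ler_piMr//; have := g0 x; rewrite -{1}(fineK (gfin x)) lee_fin.
      rewrite le_eqVlt => /predU1P[<-|gx]; first by rewrite mulr0.
      by rewrite expRN lnK// mulVf// gt_eqF.
  + by move=> x; rewrite lee_fin mulr_ge0// expR_ge0.
  + apply/measurable_EFinP; apply: measurable_funM => //.
    by apply: measurableT_comp => //; exact: measurableT_comp.
Qed.

Lemma integral_probability_cst (P : probability T R) (c : R) :
  \int[P]_x c%:E = c%:E.
Proof.
rewrite (integral_cst P measurableT c%:E) -[RHS]mule1; congr (_ * _).
exact: probability_setT.
Qed.

(** Integrate [1 + s <= expR s] at [s = t x - l x], where [l] is the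
    log-density: this gives [t + 1 <= l + expR t * expR (- l)], whose last term
    integrates to at most [\int e^t dnu].  The work lies in the integrability
    of [l]: its negative part is below [expR (- l)], of integral at most [1], so
    [KL] is well defined and its finiteness bounds the positive part. *)
Lemma Gibbs_variational mu nu (t : T -> R) (M : R) :
    measurable_fun setT t -> (forall x, `|t x| <= M)%R ->
  \int[mu]_x (t x)%:E + 1 <= KL mu nu + \int[nu]_x (expR (t x))%:E.
Proof.
move=> mt tM.
have exp_ge0 : 0 <= \int[nu]_x (expR (t x))%:E.
  by apply: integral_ge0 => x _; rewrite lee_fin expR_ge0.
have [munu|nmunu] := pselect (mu `<< nu); last first.
  by rewrite /KL asboolF// addye ?leey// gt_eqF// (lt_le_trans _ exp_ge0).
have [l [ml KLE chg]] := log_density munu.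
have mexp (f : T -> R) : measurable_fun setT f ->
    measurable_fun setT (fun x => (expR (f x))%:E).
  by move=> mf; apply/measurable_EFinP; exact: measurableT_comp.
have mEl : measurable_fun setT (EFin \o l) by exact/measurable_EFinP.
have negl : \int[mu]_x (EFin \o l)^\- x < +oo.
  apply: (@le_lt_trans _ _ (\int[mu]_x (1 * expR (- l x))%:E)).
    apply: ge0_le_integral => //.
    - exact: measurable_funeneg.
    - under eq_fun do rewrite mul1r.
      by apply: mexp; exact: measurableT_comp.
    - move=> x _; rewrite mul1r funenegE /= -EFin_max lee_fin ge_max expR_ge0.
      by rewrite andbT; have := expR_ge1Dx (- l x); lra.
  apply: le_lt_trans (chg (cst 1%R) _ _) _ => //.
  by rewrite integral_probability_cst ltry.
have [KLoo|KLoo] := eqVneq (KL mu nu) +oo.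
  by rewrite KLoo addye ?leey// gt_eqF// (lt_le_trans _ exp_ge0).
have posl : \int[mu]_x (EFin \o l)^\+ x < +oo.
  rewrite ltNge leye_eq; apply: contra KLoo => /eqP posoo.
  rewrite KLE integralE posoo addye//.
  by case: (\int[mu]_x _) negl.
have il : mu.-integrable setT (EFin \o l).
  apply/integrableP; split => //.
  rewrite -[X in integral _ _ X]/(abse \o (EFin \o l)) fune_abse.
  rewrite ge0_integralD//.
  - exact: lte_add_pinfty.
  - exact: measurable_funepos.
  - exact: measurable_funeneg.
have it (P : probability T R) : P.-integrable setT (EFin \o t).
  apply: measurable_bounded_integrable => //.
    by rewrite ltey_eq fin_num_measure.
  exists M; split; first exact: num_real.
  by move=> N MN x _; exact: le_trans (tM x) (ltW MN).
have [ioo|ifin] := eqVneq (\int[nu]_x (expR (t x))%:E) +oo.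
  have KLfin : KL mu nu \is a fin_num by rewrite KLE integrable_fin_num.
  by rewrite ioo addey ?leey//; case: (KL mu nu) KLfin.
have le_chg : \int[mu]_x (expR (t x) * expR (- l x))%:E <=
    \int[nu]_x (expR (t x))%:E.
  apply: chg => [|x]; last exact: expR_ge0.
  exact: measurableT_comp.
have mprod : measurable_fun setT (fun x => (expR (t x) * expR (- l x))%:E).
  apply/measurable_EFinP; apply: measurable_funM; first exact: measurableT_comp.
  by apply: measurableT_comp => //; exact: measurableT_comp.
have iprod : mu.-integrable setT (fun x => (expR (t x) * expR (- l x))%:E).
  apply/integrableP; split => //.
  under eq_integral => x _ do rewrite gee0_abs ?lee_fin ?mulr_ge0 ?expR_ge0//.
  by rewrite (le_lt_trans le_chg)// ltey.
have -> : \int[mu]_x (t x)%:E + 1 = \int[mu]_x ((t x)%:E + (cst 1%R x)%:E).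
  rewrite integralD ?integral_probability_cst//; first exact: it.
  exact: finite_measure_integrable_cst.
apply: (@le_trans _ _
    (\int[mu]_x ((l x)%:E + (expR (t x) * expR (- l x))%:E))).
  apply: le_integral => //.
  - apply: integrableD => //; first exact: it.
    exact: finite_measure_integrable_cst.
  - exact: integrableD.
  - move=> x _; rewrite -!EFinD lee_fin -expRD.
    by have := expR_ge1Dx (t x - l x); rewrite /cst; lra.
by rewrite integralD// KLE leeD2l.
Qed.

Lemma KL_ge0 mu nu : 0 <= KL mu nu.
Proof.
have t0 (x : T) : (`|0 : R| <= 0)%R by rewrite normr0.
have := Gibbs_variational mu nu (measurable_cst (0%R : R)) t0.
rewrite /cst expR0 integral0 add0e integral_probability_cst.
by rewrite -[leLHS]add0e leeD2rE.
Qed.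

(** From [1 - x <= expR (- x)], taking inverses: the bound [2^-1] is what makes
    [1 <= (1 + x + 2 x^2) (1 - x) = 1 + x^2 (1 - 2 x)] true. *)
Lemma expR_le_quadratic (x : R) : (`|x| <= 2^-1 -> expR x <= 1 + x + 2 * x ^+ 2)%R.
Proof.
rewrite ler_norml => /andP[x1 x2].
have x0 : (0 < 1 - x)%R by lra.
rewrite -[x in expR x]opprK expRN -[leRHS]invrK lef_pV2 ?posrE ?expR_gt0//.
  apply: le_trans (expR_ge1Dx _); rewrite -[leRHS]invrK lef_pV2 ?posrE ?invr_gt0//.
    by rewrite -[leLHS]mul1r ler_pdivrMr//; nra.
  by nra.
by rewrite invr_gt0; nra.
Qed.

(** A Pinsker-type inequality: the variational inequality at the rescaled
    function [s = (e / M) t] gives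
    [\int s dmu <= \int s dnu + KL mu nu + 2 e^2], an excess of at most [3 e^2],
    which is then divided by [e / M]. *)
Lemma KL_integral_le mu nu (t : T -> R) (M e : R) :
    measurable_fun setT t -> (forall x, `|t x| <= M)%R ->
    (0 < M)%R -> (0 < e <= 2^-1)%R -> KL mu nu <= (e ^+ 2)%:E ->
  \int[mu]_x (t x)%:E <= \int[nu]_x (t x)%:E + (3 * e * M)%:E.
Proof.
move=> mt tM M0 /andP[e0 e2] KLe.
have it (P : probability T R) : P.-integrable setT (EFin \o t).
  apply: measurable_bounded_integrable => //.
    by rewrite ltey_eq fin_num_measure.
  exists M; split; first exact: num_real.
  by move=> N MN x _; exact: le_trans (tM x) (ltW MN).
pose s x := (e / M * t x)%R.
have eM0 : (0 < e / M)%R by rewrite divr_gt0.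
have ms : measurable_fun setT s by exact: measurable_funM.
have se x : (`|s x| <= e)%R.
  rewrite normrM gtr0_norm// -[leRHS](divfK (lt0r_neq0 M0)).
  by rewrite ler_pM2l.
have := Gibbs_variational mu nu ms se.
have ise (P : probability T R) : \int[P]_x (s x)%:E = (e / M)%:E * \int[P]_x (t x)%:E.
  rewrite /s; under eq_integral do rewrite EFinM.
  by rewrite integralZl//; exact: it.
have mexp : measurable_fun setT (fun x => (expR (s x))%:E).
  by apply/measurable_EFinP; exact: measurableT_comp.
have int_exp : \int[nu]_x (expR (s x))%:E <= \int[nu]_x (s x)%:E + (1 + 2 * e ^+ 2)%:E.
  have -> : \int[nu]_x (s x)%:E + (1 + 2 * e ^+ 2)%:E =
      \int[nu]_x ((s x)%:E + (cst (1 + 2 * e ^+ 2)%R x)%:E).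
    rewrite integralD//.
    - by rewrite integral_probability_cst.
    - rewrite /s; under eq_fun do rewrite EFinM.
      by apply: integrableZl => //; exact: it.
    - exact: finite_measure_integrable_cst.
  apply: le_integral => //.
  - apply: (le_integrable measurableT _ _ (finite_measure_integrable_cst nu (expR e) measurableT)) => //.
    move=> x _; rewrite lee_fin !ger0_norm ?expR_ge0// ler_expR.
    exact: le_trans (ler_norm _) (se x).
  - apply: integrableD => //; last exact: finite_measure_integrable_cst.
    rewrite /s; under eq_fun do rewrite EFinM.
    by apply: integrableZl => //; exact: it.
  - move=> x _; rewrite -EFinD lee_fin /cst.
    have := expR_le_quadratic (le_trans (se x) e2).
    suff : (s x ^+ 2 <= e ^+ 2)%R by lra.
    by rewrite -real_normK ?num_real// lerXn2r ?nnegrE// ltW.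
move=> /le_trans/(_ (leeD KLe int_exp)).
have tfin (P : probability T R) : \int[P]_x (t x)%:E \is a fin_num.
  by apply: integrable_fin_num => //; exact: it.
rewrite !ise -(fineK (tfin mu)) -(fineK (tfin nu)).
rewrite -!EFinM -!EFinD !lee_fin /=.
set a := fine _; set b := fine _ => h.
have : (e / M * (a - b) <= 3 * e ^+ 2)%R by lra.
rewrite (_ : 3 * e ^+ 2 = e / M * (3 * e * M))%R ?ler_pM2l//; first lra.
by field; rewrite gt_eqF.
Qed.

End relative_entropy.

(** * A coupling that moves only the total variation *)

Section maximal_coupling.
Context d (T : measurableType d) (R : realType).
Local Open Scope ereal_scope.

Definition diagonal (x : T) : T * T := (x, x).

Lemma measurable_diagonal : measurable_fun setT diagonal.
Proof. exact: measurable_fun_pair. Qed.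

(** The image measure gets a name of its own so that its measure structure can be
    found without a proof of measurability of [diagonal] in the context. *)
Section diagonal_image.
Variable gam : {measure set T -> \bar R}.

Definition diagonal_image : set (T * T) -> \bar R := pushforward gam diagonal.

Let diagonal_image0 : diagonal_image set0 = 0.
Proof. by rewrite /diagonal_image /pushforward preimage_set0 measure0. Qed.

Let diagonal_image_ge0 A : 0 <= diagonal_image A.
Proof. by have mf := measurable_diagonal; exact: measure_ge0. Qed.

Let diagonal_image_sigma_additive : semi_sigma_additive diagonal_image.
Proof.
by have mf := measurable_diagonal; exact: measure_semi_sigma_additive.
Qed.

HB.instance Definition _ := isMeasure.Build _ _ _ diagonal_image
  diagonal_image0 diagonal_image_ge0 diagonal_image_sigma_additive.

End diagonal_image.

(** [P] is the value given to the normalization of the zero measure; multiplying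
    back by the mass [0] erases it, which avoids treating a zero excess mass
    separately in the construction of couplings. *)
Lemma mnormalizeK (al : {finite_measure set T -> \bar R}) (P : probability T R)
    (A : set T) : measurable A ->
  (fine (al setT))%:E * mnormalize al P A = al A.
Proof.
move=> mA; rewrite fineK ?fin_num_measure// /mnormalize.
have [al0|al0] := eqVneq (al setT) 0.
  by rewrite al0 mul0e; apply/esym/eqP; rewrite -measure_le0 -al0 le_measure ?inE.
rewrite /= lt_eqF ?ltey_eq ?fin_num_measure//=.
rewrite muleCA -[X in X * (_)%:E](@fineK _ (al setT)) ?fin_num_measure//.
rewrite -EFinM divff ?mule1// fine_eq0// fin_num_measure//.
Qed.

(** The mass [gam] stays on the diagonal, while the excesses [al] and [be], both
    of mass [m], are coupled independently: for [m > 0] the second summand is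
    [m^-1 al \x be]. *)
Definition split_coupling (gam al be : {measure set T -> \bar R})
    (m : {nonneg R}) (P : probability T R) : set (T * T) -> \bar R :=
  measure_add (diagonal_image gam)
    (mscale m (mnormalize al P \x mnormalize be P)).

HB.instance Definition _ gam al be m P :=
  Measure.on (split_coupling gam al be m P).

(** Both excesses have the same mass because [mu] and [nu] have the same mass;
    the diagonal part of the coupling costs nothing, and the independent part,
    of mass [al setT], costs at most [D] per unit of mass. *)
Lemma coupling_of_decomposition (gam : {measure set T -> \bar R})
    (al be : {finite_measure set T -> \bar R})
    (mu nu : probability T R) :
    (forall A, measurable A -> mu A = gam A + al A) ->
    (forall A, measurable A -> nu A = gam A + be A) ->
  exists pi : probability (T * T)%type R,
    (forall A, measurable A ->
      pushforward pi fst A = mu A /\ pushforward pi snd A = nu A) /\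
    (forall (c : T * T -> R) (D : R), measurable_fun setT c ->
      (forall z, 0 <= c z <= D)%R -> (forall x, c (x, x) = 0)%R ->
      \int[pi]_z (c z)%:E <= D%:E * al setT).
Proof.
move=> muE nuE.
have gfin : gam setT \is a fin_num.
  rewrite ge0_fin_numE// (le_lt_trans (leeDl _ (measure_ge0 al setT)))// -muE//.
  by rewrite (le_lt_trans (probability_le1 _ _))// ltry.
have albe : al setT = be setT.
  have := muE _ measurableT; have := nuE _ measurableT.
  rewrite (@probability_setT _ _ _ mu) (@probability_setT _ _ _ nu) => ->.
  move=> /eqP; rewrite -(fineK gfin).
  rewrite -(fineK (fin_num_measure al _ measurableT)).
  rewrite -(fineK (fin_num_measure be _ measurableT)) -!EFinD eqe => /eqP h.
  by congr _%:E; lra.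
have m0 : (0 <= fine (al setT))%R by rewrite fine_ge0.
pose m := NngNum m0.
pose pi0 := split_coupling gam al be m mu.
(* a marginal of [m (al / m \x be / m)] is [m (al / m) = al], [be / m] being a
   probability *)
have pi0fst A : measurable A -> pi0 (fst @^-1` A) = mu A.
  move=> mA; rewrite muE// /pi0 /split_coupling measure_addE; congr (_ + _).
  rewrite -(mnormalizeK al mu mA) /mscale; congr (_ * _).
  rewrite (_ : _ @^-1` _ = A `*` setT); last first.
    by apply/seteqP; split => -[x y] //= [].
  transitivity (mnormalize al mu A * mnormalize be mu setT).
    exact: product_measure1E.
  by rewrite -[RHS]mule1; congr (_ * _); exact: probability_setT.
have pi0snd A : measurable A -> pi0 (snd @^-1` A) = nu A.
  move=> mA; rewrite nuE// /pi0 /split_coupling measure_addE; congr (_ + _).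
  rewrite -(mnormalizeK be mu mA) /mscale -albe; congr (_ * _).
  rewrite (_ : _ @^-1` _ = setT `*` A); last first.
    by apply/seteqP; split => -[x y] //= [].
  transitivity (mnormalize al mu setT * mnormalize be mu A).
    exact: product_measure1E.
  by rewrite -[RHS]mul1e; congr (_ * _); exact: probability_setT.
have pi01 : pi0 setT = 1.
  by rewrite -[setT](preimage_setT fst) pi0fst//; exact: probability_setT.
pose pi : probability (T * T)%type R :=
  HB.pack pi0 (Measure_isProbability.Build _ _ _ pi0 pi01).
exists pi; split; first by move=> A mA; split; [exact: pi0fst|exact: pi0snd].
move=> c D mc cD c0.
have mEc : measurable_fun setT (EFin \o c) by exact/measurable_EFinP.
have Ec0 z : 0 <= (c z)%:E by rewrite lee_fin; have /andP[] := cD z.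
rewrite [leLHS](_ : _ = \int[diagonal_image gam]_z (c z)%:E +
  \int[mscale m (mnormalize al mu \x mnormalize be mu)]_z (c z)%:E); last first.
  exact: ge0_integral_measure_add.
have mf := measurable_diagonal.
rewrite [X in X + _](_ : _ = 0); last first.
  transitivity (\int[gam]_(x in diagonal @^-1` setT) ((EFin \o c) \o diagonal) x).
    exact: (ge0_integral_pushforward mf).
  by rewrite integral0_eq// => x _; rewrite /= /diagonal c0.
rewrite add0e ge0_integral_mscale//.
apply: (@le_trans _ _ (m%:num%:E *
    \int[mnormalize al mu \x mnormalize be mu]_z (cst D z)%:E)).
  apply: lee_wpmul2l; first by rewrite lee_fin.
  apply: ge0_le_integral => //; first exact/measurable_EFinP.
  by move=> z _; rewrite lee_fin; have /andP[] := cD z.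
rewrite (integral_cst _ measurableT D%:E) muleCA.
rewrite [X in _ * (_ * X)](_ : _ = 1); last first.
  transitivity (mnormalize al mu setT * mnormalize be mu setT).
    by rewrite -setXTT; exact: product_measure1E.
  rewrite -[RHS]mule1; congr (_ * _); exact: probability_setT.
by rewrite mule1 /= fineK ?fin_num_measure.
Qed.

(** For a Hahn decomposition [(A, N)] of [mu - nu], the infimum of [mu] and [nu]
    is [nu] on [A] and [mu] on [N], and the excesses of [mu] and [nu] over it are
    the positive and negative parts of [mu - nu]. *)
Lemma Hahn_coupling (mu nu : probability T R) :
  exists (A : set T) (pi : probability (T * T)%type R),
    [/\ measurable A,
        forall B, measurable B ->
          pushforward pi fst B = mu B /\ pushforward pi snd B = nu B &
        forall (c : T * T -> R) (D : R), measurable_fun setT c ->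
          (forall z, 0 <= c z <= D)%R -> (forall x, c (x, x) = 0)%R ->
          \int[pi]_z (c z)%:E <= D%:E * (mu A - nu A)].
Proof.
pose sg := cadd (charge_of_finite_measure mu)
                (cscale (-1) (charge_of_finite_measure nu)).
have sgE B : sg B = mu B - nu B by rewrite /sg /cadd /= cscaleN1.
have [A [N AN]] := Hahn_decomposition sg.
have [[mA posA] [mN negN] ANT AN0] := AN.
have Bsplit (P : probability T R) B : measurable B ->
    P B = P (B `&` A) + P (B `&` N).
  move=> mB; rewrite -measureU; [|exact: measurableI|exact: measurableI|].
    by rewrite -setIUr ANT setIT.
  by rewrite setIACA AN0 setI0.
have finE (P : probability T R) B : measurable B -> P B = (fine (P B))%:E.
  by move=> mB; rewrite fineK ?fin_num_measure.
pose gam : {measure set T -> \bar R} :=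
  measure_add (mrestr nu mA) (mrestr mu mN).
have gamE B : measurable B -> gam B = nu (B `&` A) + mu (B `&` N).
  by move=> mB; exact: measure_addE.
have posE B : measurable B -> jordan_pos AN B = mu (B `&` A) - nu (B `&` A).
  by move=> mB; rewrite jordan_posE cjordan_posE /crestr0 mem_set//; exact: sgE.
have negE B : measurable B -> jordan_neg AN B = nu (B `&` N) - mu (B `&` N).
  move=> mB; rewrite jordan_negE cjordan_negE /crestr0 mem_set//.
  have mBN := measurableI _ _ mB mN.
  transitivity (- (mu (B `&` N) - nu (B `&` N))); first by rewrite -sgE.
  by rewrite fin_num_oppeB ?fin_num_measure// addeC.
have [B mB|B mB|pi [margin cost]] :=
    @coupling_of_decomposition gam (jordan_pos AN) (jordan_neg AN) mu nu.
- have mBA := measurableI _ _ mB mA; have mBN := measurableI _ _ mB mN.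
  rewrite gamE// [X in _ = _ + X](posE _ mB) Bsplit//.
  rewrite (finE mu _ mBA) (finE mu _ mBN) (finE nu _ mBA).
  by rewrite -!EFinD; congr _%:E; ring.
- have mBA := measurableI _ _ mB mA; have mBN := measurableI _ _ mB mN.
  rewrite gamE// [X in _ = _ + X](negE _ mB) Bsplit//.
  rewrite (finE mu _ mBN) (finE nu _ mBA) (finE nu _ mBN).
  by rewrite -!EFinD; congr _%:E; ring.
exists A, pi; split => // c D mc cD c0.
by rewrite (le_trans (cost _ _ mc cD c0))// [X in _ * X]posE// setTI.
Qed.

End maximal_coupling.

(** * Measurability on a separable metric space *)

Section borel_measurability.
Context {R : realType} (X : pmetricType R).

Lemma open_lt_mdist (q : X) (r : R) : open [set x : X | mdist q x < r].
Proof.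
rewrite openE => x /= qx; rewrite /interior.
apply/nbhs_ballP; exists (r - mdist q x); first by rewrite /= subr_gt0.
move=> y; rewrite ballEmdist /= => xy.
by rewrite (le_lt_trans (metric_triangle q x y))// -ltrBrDl.
Qed.

Lemma measurable_mdist_from (q : X) :
  measurable_fun setT (fun x : borel X => mdist q (x : X)).
Proof.
apply: (measurability _ (RGenInftyO.measurableE R)) => //.
move=> _ [_ [r ->] <-]; rewrite setTI.
apply: sub_sigma_algebra.
rewrite (_ : _ @^-1` _ = [set x : X | mdist q x < r]); first exact: open_lt_mdist.
by apply/seteqP; split => x /=; rewrite in_itv.
Qed.

Lemma continuous_measurable_borel (f : X -> R) : continuous f ->
  measurable_fun setT (f : borel X -> R).
Proof.
move=> cf; apply: (measurability _ (RGenOpens.measurableE R)) => //.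
move=> _ [_ [a [b ->]] <-]; rewrite setTI; apply: sub_sigma_algebra.
by apply: open_comp => [x _|]; [exact: cf|exact: interval_open].
Qed.

(** Separability is essential, the sigma-algebra on pairs being the product one:
    by the triangle inequality, [mdist x y < r] iff
    [mdist q x + mdist q y < r] for some [q] in a countable dense set, and for
    each [q] this condition depends on [x] and [y] through measurable functions
    of one variable. *)
Lemma measurable_mdist : separable X ->
  measurable_fun setT (fun z : borel X * borel X => mdist (z.1 : X) (z.2 : X)).
Proof.
move=> [Q Qcount Qdense].
apply: (measurability _ (RGenInftyO.measurableE R)) => //.
move=> _ [_ [r ->] <-]; rewrite setTI.
rewrite (_ : _ @^-1` _ = \bigcup_(q in Q)
    [set z : borel X * borel X | mdist q (z.1 : X) + mdist q (z.2 : X) < r]).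
  rewrite bigcup_set_type; apply: countable_bigcupT_measurable => [|q].
    have /countable_injP[f finj] := Qcount.
    apply/countable_injP; exists (f \o val) => p q _ _ /= fpq.
    by apply/val_inj/finj; rewrite ?inE//; exact: set_valP.
  rewrite -[X in measurable X]setTI.
  rewrite (_ : [set z | _] = (fun z : borel X * borel X =>
    mdist (\val q) (z.1 : X) + mdist (\val q) (z.2 : X)) @^-1` `]-oo, r[%classic).
    have mq := measurable_mdist_from (\val q).
    by apply: measurable_funD => //; apply: measurableT_comp mq _.
  by apply/seteqP; split => z /=; rewrite in_itv.
apply/seteqP; split => -[x y] /=; rewrite in_itv /=.
  move=> xyr.
  (* a point [q] of the dense set within [e] of [x] adds less than [2 e] *)
  pose e := (r - mdist x y) / 2.
  have e0 : 0 < e by rewrite divr_gt0// subr_gt0.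
  have [q [/= xq Qq]] : [set z | mdist x z < e] `&` Q !=set0.
    apply: Qdense; last exact: open_lt_mdist.
    by exists x; rewrite /= mdistxx.
  exists q => //=; have := metric_triangle q x y.
  rewrite (metric_sym q x); move: xq; rewrite /e; lra.
move=> [q Qq /=]; apply: le_lt_trans.
by rewrite (metric_sym q x); exact: metric_triangle.
Qed.

End borel_measurability.

Lemma cvge_fin_near (R : realType) (u : nat -> \bar R) (a : R) :
    (forall e : R, 0 < e ->
      \forall n \near \oo, ((a - e)%:E <= u n <= (a + e)%:E)%E) ->
  u n @[n --> \oo] --> a%:E.
Proof.
move=> ua; apply/fine_cvgP.
have ufin (x : \bar R) (b c : R) : (b%:E <= x <= c%:E)%E -> x \is a fin_num.
  by case: x => [r| |]//=; rewrite ?leye_eq ?leeNy_eq ?andbF.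
split; first by near=> n; apply: (ufin _ (a - 1) (a + 1)); near: n; exact: ua.
apply/cvgrPdist_le => e e0; near=> n.
have : ((a - e)%:E <= u n <= (a + e)%:E)%E by near: n; exact: ua.
move=> /[dup] /ufin ufinn; rewrite -(fineK ufinn) !lee_fin /= => /andP[h1 h2].
by rewrite ler_norml; apply/andP; split; lra.
Unshelve. all: by end_near. Qed.

(** * From entropy to sublinear expectations and Wasserstein distance *)

Section sets_of_probabilities.
Context d (T : measurableType d) (R : realType).
Implicit Types (mu nu : probability T R) (P Q : set (probability T R)).
Local Open Scope ereal_scope.

Lemma KL_measure_le mu nu (A : set T) (e : R) :
    measurable A -> (0 < e <= 2^-1)%R -> KL mu nu <= (e ^+ 2)%:E ->
  mu A - nu A <= (3 * e)%:E.
Proof.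
move=> mA e0 KLe.
have m1 : measurable_fun setT (\1_A : T -> R) by exact: measurable_indic.
have le1 x : (`|\1_A x : R| <= 1)%R.
  by rewrite indicE; case: (_ \in _); rewrite ?normr1 ?normr0.
have := KL_integral_le m1 le1 ltr01 e0 KLe.
rewrite !integral_indic// setIT mulr1 => h.
by rewrite leeBlDl ?fin_num_measure.
Qed.

Lemma KL_sets_ge0 P Q : P !=set0 -> 0 <= KL_sets P Q.
Proof.
move=> [mu Pmu]; apply: le_ereal_sup_tmp; exists (ereal_inf [set KL mu nu | nu in Q]).
  by exists mu.
by apply: le_ereal_inf_tmp => _ [nu _ <-]; exact: KL_ge0.
Qed.

(** Strictness of the hypothesis provides a near-minimizer, so the infimum
    in [KL_sets] need not be attained. *)
Lemma KL_sets_lt P Q (r : \bar R) mu : KL_sets P Q < r -> P mu ->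
  exists2 nu, Q nu & KL mu nu <= r.
Proof.
move=> PQr Pmu.
have : ereal_inf [set KL mu nu | nu in Q] < r.
  by apply: le_lt_trans PQr; apply: ereal_sup_ubound; exists mu.
by move=> /ereal_inf_lt[_ [nu Qnu <-] /ltW]; exists nu.
Qed.

Lemma sublinear_expectation_le P Q (phi : T -> R) (M e : R) :
    measurable_fun setT phi -> (forall x, `|phi x| <= M)%R -> (0 < M)%R ->
    (0 < e <= 2^-1)%R -> KL_sets P Q < (e ^+ 2)%:E ->
  sublinear_expectation P phi <= sublinear_expectation Q phi + (3 * e * M)%:E.
Proof.
move=> mphi phiM M0 e0 PQ; apply: ge_ereal_sup => _ [mu Pmu <-].
have [nu Qnu KLe] := KL_sets_lt PQ Pmu.
apply: le_trans (KL_integral_le mphi phiM M0 e0 KLe) _.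
by apply: leeD2r; apply: ereal_sup_ubound; exists nu.
Qed.

Lemma sublinear_expectation_fin P (phi : T -> R) (M : R) :
    P !=set0 -> measurable_fun setT phi -> (forall x, `|phi x| <= M)%R ->
  sublinear_expectation P phi \is a fin_num.
Proof.
move=> [mu Pmu] mphi phiM.
have bnd nu : (- M)%:E <= \int[nu]_x (phi x)%:E <= M%:E.
  have : `|\int[nu]_x (phi x)%:E| <= M%:E.
    rewrite -(integral_probability_cst nu M).
    apply: le_trans (le_abse_integral _ _ _) _ => //.
      exact/measurable_EFinP.
    apply: ge0_le_integral => //.
    - by apply/measurable_EFinP; exact: measurableT_comp.
    - by move=> x _; rewrite lee_fin.
  by case: (\int[nu]_x _) => [r| |]//=; rewrite !lee_fin ler_norml.
have up : sublinear_expectation P phi <= M%:E.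
  by apply: ge_ereal_sup => _ [nu _ <-]; have /andP[] := bnd nu.
have lo : (- M)%:E <= sublinear_expectation P phi.
  have /andP[h _] := bnd mu; apply: le_trans h _.
  by apply: ereal_sup_ubound; exists mu.
by rewrite fin_numElt (lt_le_trans _ lo) ?(le_lt_trans up) ?ltry ?ltNyr.
Qed.

End sets_of_probabilities.

Section wasserstein_bound.
Context {R : realType} (X : pmetricType R).
Implicit Types (mu nu : borel_prob X) (P Q : set (borel_prob X)).
Local Open Scope ereal_scope.

Lemma W1_ge0 mu nu : 0 <= W1 mu nu.
Proof.
apply: le_ereal_inf_tmp => _ [pi _ <-]; apply: integral_ge0 => z _.
by rewrite lee_fin mdist_ge0.
Qed.

(** The entropy enters through [mu A - nu A] only, for one set [A]; when it is
    [KL nu mu] that is small, [KL_measure_le] is applied to the complement of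
    [A], since [mu A - nu A = nu (~` A) - mu (~` A)]. *)
Lemma W1_le mu nu (D e : R) : separable X ->
    (forall x y : X, mdist x y <= D)%R -> (0 < e <= 2^-1)%R ->
    KL mu nu <= (e ^+ 2)%:E \/ KL nu mu <= (e ^+ 2)%:E ->
  W1 mu nu <= (D * (3 * e))%:E.
Proof.
move=> sepX leD e0 KLe.
have D0 : (0 <= D)%R by rewrite -(mdistxx (point : X)).
have [A [pi [mA margin cost]]] := Hahn_coupling mu nu.
have diff : mu A - nu A <= (3 * e)%:E.
  case: KLe => [KLe|KLe]; first exact: KL_measure_le KLe.
  have := KL_measure_le (measurableC mA) e0 KLe.
  rewrite !probability_setC// -(fineK (fin_num_measure mu _ mA)).
  rewrite -(fineK (fin_num_measure nu _ mA)) -!EFinD !lee_fin; lra.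
rewrite EFinM; apply: le_trans (lee_wpmul2l _ diff); last by rewrite lee_fin.
apply: le_trans (cost _ D (measurable_mdist sepX) _ _) => [|z|x].
- by apply: ereal_inf_lbound; exists pi.
- by rewrite mdist_ge0 leD.
- exact: mdistxx.
Qed.

Lemma W1_sets_ge0 P Q : P !=set0 -> 0 <= W1_sets P Q.
Proof.
move=> [mu Pmu]; rewrite /W1_sets le_max; apply/orP; left.
apply: le_ereal_sup_tmp; exists (ereal_inf [set W1 mu nu | nu in Q]).
  by exists mu.
by apply: le_ereal_inf_tmp => _ [nu _ <-]; exact: W1_ge0.
Qed.

(** The two one-sided suprema in [W1_sets] use the two one-sided entropies, one
    in each order of the arguments of [KL]. *)
Lemma W1_sets_le P Q (D e : R) : separable X ->
    (forall x y : X, mdist x y <= D)%R -> (0 < e <= 2^-1)%R ->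
    KL_sets P Q < (e ^+ 2)%:E -> KL_sets Q P < (e ^+ 2)%:E ->
  W1_sets P Q <= (D * (3 * e))%:E.
Proof.
move=> sepX leD e0 PQ QP; rewrite /W1_sets ge_max; apply/andP; split.
- apply: ge_ereal_sup => _ [mu Pmu <-].
  have [nu Qnu KLe] := KL_sets_lt PQ Pmu.
  apply: le_trans (W1_le sepX leD e0 (or_introl KLe)).
  by apply: ereal_inf_lbound; exists nu.
- apply: ge_ereal_sup => _ [nu Qnu <-].
  have [mu Pmu KLe] := KL_sets_lt QP Qnu.
  apply: le_trans (W1_le sepX leD e0 (or_intror KLe)).
  by apply: ereal_inf_lbound; exists mu.
Qed.

End wasserstein_bound.

(** * The convergence theorem *)

Theorem corollary3 (R : realType) (X : pmetricType R)
    (P : set (borel_prob X)) (Pn : nat -> set (borel_prob X))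
    (X_polish : polish R X)
    (P_nonempty : P !=set0) (P_compact : weakly_compact P)
    (P_convex : convex_probs P)
    (Pn_nonempty : forall n, (1 <= n)%N -> Pn n !=set0)
    (Pn_compact : forall n, (1 <= n)%N -> weakly_compact (Pn n))
    (Pn_convex : forall n, (1 <= n)%N -> convex_probs (Pn n))
    (KL_cvg0 : KL_sym (Pn n) P @[n --> \oo] --> 0%E) :
  (forall phi : X -> R, Cb phi ->
     sublinear_expectation (Pn n) phi @[n --> \oo]
       --> sublinear_expectation P phi) /\
  ((diameter X < +oo)%E -> W1_sets (Pn n) P @[n --> \oo] --> 0%E).
Proof.
have KL_near (e : R) : 0 < e -> \forall n \near \oo,
    (KL_sets (Pn n) P < (e ^+ 2)%:E)%E /\ (KL_sets P (Pn n) < (e ^+ 2)%:E)%E.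
  move=> e0.
  have e20 : 0 < e ^+ 2 by rewrite exprn_gt0.
  have lt_near : \forall n \near \oo, (KL_sym (Pn n) P < (e ^+ 2)%:E)%E.
    have := KL_cvg0 [set x | (x < (e ^+ 2)%:E)%E].
    apply; apply: open_nbhs_nbhs; split; first exact: open_ereal_lt_ereal.
    by rewrite /= lte_fin.
  near=> n.
  have Pn0 : Pn n !=set0 by apply: Pn_nonempty; near: n; exact: nbhs_infty_ge.
  have : (KL_sym (Pn n) P < (e ^+ 2)%:E)%E by near: n.
  rewrite /KL_sym => KLlt.
  have PnP := KL_sets_ge0 P Pn0; have PPn := KL_sets_ge0 (Pn n) P_nonempty.
  split; apply: le_lt_trans KLlt; [exact: leeDl|exact: leeDr].
(* [e'] is the entropy scale at which the error [c * (3 * e')] is below [e] *)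
have small (c e : R) : 0 < c -> 0 < e ->
    exists e' : R, 0 < e' <= 2^-1 /\ c * (3 * e') <= e.
  move=> c0 e0; exists (Num.min 2^-1 (e / (3 * c))); split.
    by rewrite lt_min ge_min lexx divr_gt0 ?mulr_gt0// invr_gt0 !andbT.
  have : Num.min 2^-1 (e / (3 * c)) <= e / (3 * c) by rewrite ge_min lexx orbT.
  by rewrite ler_pdivlMr ?mulr_gt0//; lra.
split=> [phi [phi_cont phi_bnd]|diam].
- have mphi := continuous_measurable_borel phi_cont.
  have [M M0 phiM] : exists2 M : R, 0 < M & forall x, `|phi x| <= M.
    case: phi_bnd => M [_ hM]; exists (`|M| + 1); first by rewrite ltr_wpDl.
    by move=> x; apply: hM => //; rewrite (le_lt_trans (ler_norm M))// ltrDl.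
  rewrite -(fineK (sublinear_expectation_fin P_nonempty mphi phiM)).
  apply: cvge_fin_near => e e0.
  have [e' [he' le_e]] := small M e M0 e0; have /andP[e'0 _] := he'.
  near=> n.
  have [PnP PPn] : (KL_sets (Pn n) P < (e' ^+ 2)%:E)%E /\
    (KL_sets P (Pn n) < (e' ^+ 2)%:E)%E by near: n; exact: KL_near.
  have Pn0 : Pn n !=set0 by apply: Pn_nonempty; near: n; exact: nbhs_infty_ge.
  have := sublinear_expectation_le mphi phiM M0 he' PnP.
  have := sublinear_expectation_le mphi phiM M0 he' PPn.
  rewrite -(fineK (sublinear_expectation_fin P_nonempty mphi phiM)).
  rewrite -(fineK (sublinear_expectation_fin Pn0 mphi phiM)).
  by rewrite -!EFinD !lee_fin => h1 h2; apply/andP; split; lra.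
- have [sepX _] := X_polish.
  have [D D0 leD] : exists2 D : R, 0 < D & forall x y : X, mdist x y <= D.
    have le_diam (x y : X) : ((mdist x y)%:E <= diameter X)%E.
      by apply: ereal_sup_ubound; exists (x, y).
    exists (fine (diameter X) + 1).
      by rewrite ltr_wpDl// fine_ge0// (le_trans _ (le_diam point point))// lee_fin mdist_ge0.
    have diam_fin : diameter X \is a fin_num.
      rewrite ge0_fin_numE//.
      by rewrite (le_trans _ (le_diam point point))// lee_fin mdist_ge0.
    move=> x y; have := le_diam x y; rewrite -(fineK diam_fin) lee_fin => h.
    by rewrite (le_trans h)// lerDl.
  apply: cvge_fin_near => e e0.
  have [e' [he' le_e]] := small D e D0 e0; have /andP[e'0 _] := he'.
  near=> n.
  have [PnP PPn] : (KL_sets (Pn n) P < (e' ^+ 2)%:E)%E /\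
    (KL_sets P (Pn n) < (e' ^+ 2)%:E)%E by near: n; exact: KL_near.
  have Pn0 : Pn n !=set0 by apply: Pn_nonempty; near: n; exact: nbhs_infty_ge.
  rewrite sub0r add0r; apply/andP; split.
    by apply: le_trans (W1_sets_ge0 P Pn0); rewrite lee_fin oppr_le0 ltW.
  by rewrite (le_trans (W1_sets_le sepX leD he' PnP PPn))// lee_fin.
Unshelve. all: by end_near. Qed.
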